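(* Let $\alpha,\beta\in\mathbb{C}$ with $\alpha\neq 0$, let $f(z)=\alpha\sin(z+\beta)$, and let $A(f)$ be the fast escaping set of $f$, with complement $A(f)^c=\mathbb{C}\setminus A(f)$. Let $S\subset\mathbb{C}$ be any vertical strip of width $2\pi$. Then $$\operatorname{Area}(S\cap A(f)^c)\leq (4\pi+4r)\left(x^{*}+r+8c\,e^{4-x^*/2}\frac{r}{1-e^{-r/2}}\right),$$ where $$r=\frac{1}{8}, \qquad c=\frac{536\sqrt{2}}{|\alpha|}+\frac{1}{|\alpha|^2},$$ and $$x^*=\max\Big\{\log\Big(1+\frac{18K}{|\alpha|}\Big),\ \log\Big(\frac{8(K+1)}{|\alpha|}\Big),\ 6\log 2,\ 12+2\log c\Big\}\quad\text{with } K=\max\{|\alpha|/2,|\beta|\}.$$ In particular, if $f(z)=\sin z$ or $f(z)=\cos z$, then $$\operatorname{Area}(S\cap A(f)^c)<361.$$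
   Context: Area means two-dimensional Lebesgue measure. A vertical strip of width $2\pi$ is a set $\{z\in\mathbb{C}: a\leq \operatorname{Re} z\leq a+2\pi\}$ with $a\in\mathbb{R}$. $\mathbb{N}$ denotes the natural numbers, including $0$. For a transcendental entire function $f$, $f^{\circ n}$ denotes its $n$-th iterate. The maximal modulus function is $M(r)=M(r,f):=\max_{|z|=r}|f(z)|$ for $r>0$, and $M^{\circ n}$ denotes the $n$-th iterate of $r\mapsto M(r)$. The fast escaping set is $$A(f):=\{z\in\mathbb{C}: \text{ there is } \ell\in\mathbb{N} \text{ such that } |f^{\circ(n+\ell)}(z)|\geq M^{\circ n}(R) \text{ for all } n\in\mathbb{N}\},$$ where $R>0$ is a constant such that $M^{\circ n}(R)\to\infty$ as $n\to\infty$; it is known that $A(f)$ does not depend on the choice of such $R$. *)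

(* Defs.v *)
From HB Require Import structures.
From mathcomp Require Import all_boot all_order all_algebra.
From mathcomp Require Export complex.
From mathcomp Require Import all_classical all_reals all_analysis.

Set Implicit Arguments.
Unset Strict Implicit.
Unset Printing Implicit Defensive.

Import Order.TTheory GRing.Theory Num.Theory.
Import numFieldNormedType.Exports.

Local Open Scope classical_set_scope.
Local Open Scope ring_scope.
Local Open Scope complex_scope.

Section Defs.
Variable R : realType.
Implicit Types (z : R[i]) (f : R[i] -> R[i]) (A : set R[i]).

(* The norm `|z| of R[i] takes its values in R[i]; [cabs] is R-valued. *)
Definition cabs z : R := ComplexField.Normc.normc z.

(* e^(x + iy) = e^x (cos y + i sin y) *)
Definition cexp z : R[i] :=
  (expR (complex.Re z))%:C * (cos (complex.Im z) +i* sin (complex.Im z)).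

Definition csin z : R[i] := (cexp ('i%C * z) - cexp (- ('i%C * z))) / (2 * 'i%C).

Definition ccos z : R[i] := (cexp ('i%C * z) + cexp (- ('i%C * z))) / 2.

(* For continuous f and r > 0 the supremum is attained, as the circle is
   compact and nonempty. *)
Definition max_modulus f (r : R) : R :=
  sup [set cabs (f z) | z in [set z | cabs z = r]].

(* Admissible constants in the definition of the fast escaping set. *)
Definition escaping_radius f (R0 : R) : Prop :=
  0 < R0 /\ iter n (max_modulus f) R0 @[n --> \oo] --> +oo.

(* A(f); the set is meant for R0 with [escaping_radius f R0], and does not
   depend on the choice of such R0 when f is transcendental entire. *)
Definition fast_escaping f (R0 : R) : set R[i] :=
  [set z | exists l : nat, forall n : nat,
     iter n (max_modulus f) R0 <= cabs (iter (n + l) f z)].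

Definition vertical_strip (a : R) : set R[i] :=
  [set z | a <= complex.Re z <= a + 2 * pi].

(* The product sigma-algebra consists of the Borel sets of the plane, so this is
   two-dimensional Lebesgue measure for Borel A; fast escaping sets of entire
   functions are Borel (countable unions of closed sets). *)
Definition area A : \bar R :=
  ((@lebesgue_measure R) \x (@lebesgue_measure R))%E
    [set p : R * R | A (p.1 +i* p.2)].

End Defs.

(* Main.v *)
(* Put w = z + beta. On pieces of a horizontal band at height Y the map f expands
   distances by a factor of order |alpha| e^Y and has values of modulus of that
   same order. Hence, for an open set U, the preimage of U in a 2 pi-wide piece
   of the band has area at most a constant times (|alpha| e^Y)^-2 times the area
   of U in the disc of radius of order |alpha| e^Y. Such a disc meets the thin
   set (Im w)^2 < |w| in area O((|alpha| e^Y)^(3/2)), so summing over the bands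
   above height X shows that the points |Im w| > X mapped to the thin set have
   small area in each strip. If a set has area at most 5/2 in every strip, then
   it meets the disc in area O(|alpha| e^Y) only, and the bound 5/2 therefore
   propagates through the iterated preimages. A point with |Im w| > X that never
   enters the thin set satisfies |f(z)| >= exp(sqrt |w|) up to constants along
   its orbit, which makes it fast escaping. So the complement of A(f) has area
   at most 4 pi X + 5/2 in a strip. *)

Require Import Defs.
From mathcomp Require Import all_boot all_order all_algebra.
From mathcomp Require Import all_classical all_reals all_analysis.
From mathcomp Require Import ring lra.

Set Implicit Arguments.
Unset Strict Implicit.
Unset Printing Implicit Defensive.

Import Order.TTheory GRing.Theory Num.Theory.
Import numFieldNormedType.Exports.

Local Open Scope classical_set_scope.
Local Open Scope ring_scope.
Local Open Scope complex_scope.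

(** * Plane area and grid cells *)

Section PlaneMeasure.
Variable R : realType.
Implicit Types (A B Q U : set (R * R)) (p q : R * R).

Local Notation mu := (@lebesgue_measure R \x @lebesgue_measure R)%E.
Local Notation pmeasurable A :=
  (measurable (A : set (measurableTypeR R * measurableTypeR R))).

Lemma pmeasurable_rect (i j : interval R) :
  pmeasurable ([set` i] `*` [set` j]).
Proof. by apply: measurableX; exact: measurable_itv. Qed.

Lemma area_rect (a b c d : R) : a <= b -> c <= d ->
  mu (`[a, b]%classic `*` `[c, d]%classic) = ((b - a) * (d - c))%:E.
Proof.
have E (x y : R) : x <= y ->
    (@lebesgue_measure R `[x, y]%classic = (y - x)%:E)%E.
  rewrite lebesgue_measure_itv/= lte_fin => xy.
  by case: ltgtP xy => // -> _; rewrite subrr.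
move=> ab cd; rewrite product_measure1E; try exact: measurable_itv.
by rewrite EFinM; congr (_ * _)%E; exact: E.
Qed.

Lemma area_le A B : pmeasurable A -> pmeasurable B -> A `<=` B ->
  (mu A <= mu B)%E.
Proof. by move=> mA mB AB; apply: (le_measure mu) => //; rewrite inE. Qed.

(** The infima of the two coordinates form the lower left corner of a square of side [d] containing
    [A]. The empty set is split off because its infimum is only a default value. *)
Lemma area_diam A (d : R) : pmeasurable A -> 0 <= d ->
  (forall p q, A p -> A q -> `|p.1 - q.1| <= d /\ `|p.2 - q.2| <= d) ->
  (mu A <= (d ^+ 2)%:E)%E.
Proof.
move=> mA d0 Ad.
have [->|/set0P[p0 Ap0]] := eqVneq A set0; first by rewrite measure0 lee_fin sqr_ge0.
have inf_prop (f : R * R -> R) : (forall p q, A p -> A q -> `|f p - f q| <= d) ->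
    forall p, A p -> inf (f @` A) <= f p <= inf (f @` A) + d.
  move=> fd p Ap; have hi : has_inf (f @` A).
    split; first by exists (f p0), p0.
    exists (f p0 - d) => _ [q Aq <-].
    by have := fd _ _ Ap0 Aq; rewrite ler_norml => /andP[_]; lra.
  apply/andP; split; first by apply: ge_inf; [exact: hi.2|exists p].
  rewrite -lerBlDr; apply: lb_le_inf; first by exists (f p0), p0.
  move=> _ [q Aq <-].
  by have := fd _ _ Ap Aq; rewrite ler_norml => /andP[_]; lra.
have h1 := inf_prop fst (fun p q Ap Aq => (Ad p q Ap Aq).1).
have h2 := inf_prop snd (fun p q Ap Aq => (Ad p q Ap Aq).2).
set x := inf _ in h1; set y := inf _ in h2.
apply: (@le_trans _ _ (mu (`[x, x + d]%classic `*` `[y, y + d]%classic))).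
  apply: area_le => //; first exact: pmeasurable_rect.
  by move=> p Ap; split => /=; rewrite in_itv/= ?h1 ?h2.
by rewrite area_rect ?lerDl// lee_fin expr2; nra.
Qed.

(** Half-open squares of side 1/(n+1), so that for fixed [n] they partition the plane. *)
Definition grid_cell (n : nat) (k : int * int) : set (R * R) :=
  `[k.1%:~R / n.+1%:R, (k.1 + 1)%:~R / n.+1%:R[%classic `*`
  `[k.2%:~R / n.+1%:R, (k.2 + 1)%:~R / n.+1%:R[%classic.

Lemma grid_cellP n k p : grid_cell n k p <->
  k = (Num.floor (p.1 * n.+1%:R), Num.floor (p.2 * n.+1%:R)).
Proof.
have n0 : 0 < n.+1%:R :> R by rewrite ltr0n.
have E (x : R) (i : int) :
    (i%:~R / n.+1%:R <= x < (i + 1)%:~R / n.+1%:R) <-> i = Num.floor (x * n.+1%:R).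
  rewrite ler_pdivrMr// ltr_pdivlMr//; split => [/floor_def//|->].
  exact: floor_itv.
case: k => k l; rewrite /grid_cell/=; split => /=.
  by rewrite !in_itv/= => -[/E -> /E ->].
by move=> [/E h /E h']; rewrite !in_itv.
Qed.

Lemma area_grid_cell n k : mu (grid_cell n k) = ((n.+1%:R ^- 2)%:E)%E.
Proof.
have n0 : 0 < n.+1%:R :> R by rewrite ltr0n.
have E (i : int) : lebesgue_measure
    (`[i%:~R / n.+1%:R, (i + 1)%:~R / n.+1%:R[%classic : set R) = (n.+1%:R^-1)%:E.
  rewrite lebesgue_measure_itv/= lte_fin ltr_pM2r ?invr_gt0// ltr_int ltrDl ltr01.
  by rewrite -EFinD -mulrBl intrD addrAC subrr add0r mul1r.
by rewrite /grid_cell product_measure1E//= !E -EFinM -invfM -expr2.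
Qed.

Lemma grid_cell_close n k p q : grid_cell n k p -> grid_cell n k q ->
  `|p.1 - q.1| <= n.+1%:R^-1 /\ `|p.2 - q.2| <= n.+1%:R^-1.
Proof.
rewrite /grid_cell/= !in_itv/= !intrD !mulrDl !mulr1z !mul1r.
set h := _^-1; set x := k.1%:~R * h; set y := k.2%:~R * h.
by move=> [/andP[? ?] /andP[? ?]] [/andP[? ?] /andP[? ?]]; split;
  rewrite ler_norml; apply/andP; split; lra.
Qed.

(** The cells are enumerated by natural numbers through [pickle], so that a union of cells becomes a
    countable disjoint union; empty sets fill the remaining indices. *)
Definition grid_piece n U (i : nat) : set (R * R) :=
  if pickle_inv i is Some k then
    if `[< grid_cell n k `<=` U >] then grid_cell n k else set0
  else set0.

Definition grid_inner n U := \bigcup_i grid_piece n U i.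

Lemma pmeasurable_grid_piece n U i : pmeasurable (grid_piece n U i).
Proof.
rewrite /grid_piece; case: pickle_inv => // k; case: ifP => // _.
exact: pmeasurable_rect.
Qed.

Lemma pmeasurable_grid_inner n U : pmeasurable (grid_inner n U).
Proof. by apply: bigcup_measurable => i _; exact: pmeasurable_grid_piece. Qed.

Lemma trivIset_grid_piece n U : trivIset setT (grid_piece n U).
Proof.
move=> i j _ _ [p []]; rewrite /grid_piece.
have := @pickle_invK (int * int)%type i; have := @pickle_invK (int * int)%type j.
case: pickle_inv => // k; case: pickle_inv => // l /= <- <-.
case: ifP => // _; case: ifP => // _.
by move=> /grid_cellP -> /grid_cellP ->.
Qed.

Lemma grid_innerP n U p : grid_inner n U p <->
  exists2 k, grid_cell n k p & grid_cell n k `<=` U.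
Proof.
split=> [[i _]|[k kp kU]].
  rewrite /grid_piece; case: pickle_inv => // k; case: ifP => // /asboolP kU kp.
  by exists k.
exists (pickle k); first exact: I.
by rewrite /grid_piece pickleK_inv asboolT.
Qed.

Lemma open_plane U p : open U -> U p -> exists2 e : R, 0 < e &
  forall q, `|p.1 - q.1| < e -> `|p.2 - q.2| < e -> U q.
Proof.
move=> oU Up; have : nbhs p U by apply: open_nbhs_nbhs.
move=> /nbhs_ballP[e e0 eU]; exists e => // q q1 q2; apply: eU.
by split.
Qed.

Lemma grid_inner_near U p : open U -> U p ->
  exists N, forall n, (N <= n)%N -> grid_inner n U p.
Proof.
move=> oU Up; have [e e0 eU] := open_plane oU Up.
exists (Num.truncn e^-1) => n nN; apply/grid_innerP.
exists (Num.floor (p.1 * n.+1%:R), Num.floor (p.2 * n.+1%:R)); first exact/grid_cellP.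
have ne : n.+1%:R^-1 < e.
  rewrite invf_plt ?posrE ?ltr0n//.
  by apply: (lt_le_trans (truncnS_gt e^-1)); rewrite ler_nat ltnS.
move=> q kq; have /grid_cell_close/(_ kq)[] := (grid_cellP n _ p).2 erefl.
by move=> h1 h2; apply: eU; [apply: le_lt_trans h1 _|apply: le_lt_trans h2 _].
Qed.

(** The sets [grid_inner n U] need not increase with [n], since the grids of mesh 1/(n+1) are not
    nested. Intersecting over all [n >= N] gives a sequence that increases with [N], and to [U]
    itself when [U] is open. *)
Definition grid_core U N := \bigcap_(n in [set n | (N <= n)%N]) grid_inner n U.

Lemma pmeasurable_grid_core U N : pmeasurable (grid_core U N).
Proof.
apply: bigcap_measurable => [|i _]; first by exists N => /=.
exact: pmeasurable_grid_inner.
Qed.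

Lemma bigcup_grid_core U : open U -> \bigcup_N grid_core U N = U.
Proof.
move=> oU; apply/seteqP; split => p.
  by move=> [N _ /(_ N (leqnn N)) /grid_innerP[k kp]]; apply.
by move=> Up; have [N NU] := grid_inner_near oU Up; exists N => // n /NU.
Qed.

Lemma open_pmeasurable U : open U -> pmeasurable U.
Proof.
move=> oU; rewrite -(bigcup_grid_core oU).
by apply: bigcup_measurable => N _; exact: pmeasurable_grid_core.
Qed.

End PlaneMeasure.

(** * Preimages under expanding maps *)

Section Covering.
Variable R : realType.
Implicit Types (A B Q U : set (R * R)) (p q : R * R).

Local Notation mu := (@lebesgue_measure R \x @lebesgue_measure R)%E.
Local Notation pmeasurable A :=
  (measurable (A : set (measurableTypeR R * measurableTypeR R))).

Definition sqnorm p : R := p.1 ^+ 2 + p.2 ^+ 2.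

Lemma continuous_pmeasurable (g : R * R -> R) (Y : set R) :
  continuous g -> measurable Y -> pmeasurable (g @^-1` Y).
Proof.
move=> cg mY; have mg : measurable_fun
    (setT : set (measurableTypeR R * measurableTypeR R)) g.
  apply: (measurability _ (measurable_realfun.RGenOInfty.measurableE R)).
  move=> _ [_ [x ->] <-]; rewrite setTI; apply: open_pmeasurable.
  by move/continuousP : cg; apply; exact: interval_open.
by have := mg measurableT _ mY; rewrite setTI.
Qed.

Lemma continuous_pmeasurable_rect (F : R * R -> R * R) (i j : interval R) :
  continuous F -> pmeasurable (F @^-1` ([set` i] `*` [set` j])).
Proof.
move=> cF; have -> : F @^-1` ([set` i] `*` [set` j]) =
    ((fst \o F) @^-1` [set` i]) `&` ((snd \o F) @^-1` [set` j]) by [].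
by apply: measurableI; apply: continuous_pmeasurable => // x;
  apply: continuous_comp; [exact: cF|exact: cvg_fst|exact: cF|exact: cvg_snd].
Qed.

Lemma bigcup_le_area (G : nat -> set (R * R)) (b : \bar R) :
  (forall n, pmeasurable (G n)) -> nondecreasing_seq G ->
  (forall n, (mu (G n) <= b)%E) -> (mu (\bigcup_n G n) <= b)%E.
Proof.
move=> mG ndG Gb; have mU : pmeasurable (\bigcup_n G n) by exact: bigcup_measurable.
apply: (cvge_to_le (nondecreasing_cvg_mu mG mU ndG)).
by apply: nearW => n; exact: Gb.
Qed.

(** A cell of side h has squared diagonal 2h^2, so its preimage in [Q] has both coordinate widths at
    most sqrt(2/m) h and area at most 2/m times that of the cell. Summing over the disjoint cells
    inside [U] and passing to the limit along the increasing cores gives the claim. *)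
Theorem area_preimage_expanding Q U (F : R * R -> R * R) (m : R) :
  0 < m -> pmeasurable Q -> continuous F -> open U ->
  (forall p q, Q p -> Q q -> m * sqnorm (p - q) <= sqnorm (F p - F q)) ->
  (mu (Q `&` F @^-1` U) <= (2 / m)%:E * mu U)%E.
Proof.
move=> m0 mQ cF oU Fm.
have m'0 : 0 <= 2 / m by rewrite divr_ge0 ?ltW.
have mcell n k : pmeasurable (F @^-1` (grid_cell n k)).
  exact: continuous_pmeasurable_rect.
have mpiece n i : pmeasurable (F @^-1` (grid_piece n U i)).
  rewrite /grid_piece; case: pickle_inv => [k|]; last by rewrite preimage_set0.
  by case: ifP => // _; rewrite preimage_set0.
have minner n : pmeasurable (F @^-1` (grid_inner n U)).
  rewrite preimage_bigcup; exact: bigcup_measurable.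
have cell_le n k : (mu (Q `&` F @^-1` (grid_cell n k)) <=
    (2 / m)%:E * mu (grid_cell n k))%E.
  set d := Num.sqrt (2 / m) * n.+1%:R^-1.
  have d0 : 0 <= d by rewrite mulr_ge0 ?sqrtr_ge0.
  have dE : d ^+ 2 = 2 / m * n.+1%:R ^- 2 by rewrite exprMn sqr_sqrtr// exprVn.
  rewrite area_grid_cell -EFinM -dE; apply: area_diam => //.
    exact: measurableI.
  move=> p q [Qp Fp] [Qq Fq].
  have := Fm p q Qp Qq; have [h1 h2] := grid_cell_close Fp Fq.
  have sq (x : R) : `|x| <= n.+1%:R^-1 -> x ^+ 2 <= n.+1%:R ^- 2.
    by move=> h; rewrite -real_normK ?num_real// -exprVn lerXn2r ?nnegrE.
  have {}h1 := sq _ h1; have {}h2 := sq _ h2.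
  rewrite /sqnorm/= in h1 h2 *; set u := _ ^- 2 in h1 h2 dE.
  move=> h; have : (p.1 - q.1) ^+ 2 + (p.2 - q.2) ^+ 2 <= d ^+ 2.
    rewrite dE mulrAC ler_pdivlMr//; nra.
  by move=> {}h; split; rewrite -(ler_pXn2r (n := 2))// ?nnegrE// real_normK ?num_real//;
    apply: le_trans h; rewrite ?lerDl ?lerDr sqr_ge0.
have inner_le n : (mu (Q `&` F @^-1` (grid_inner n U)) <= (2 / m)%:E * mu U)%E.
  apply: (@le_trans _ _ ((2 / m)%:E * mu (grid_inner n U)))%E.
    rewrite /grid_inner measure_bigcup//; last 2 first.
    - by move=> i _; exact: pmeasurable_grid_piece.
    - exact: trivIset_grid_piece.
    rewrite -nneseriesZl//; apply: (@le_trans _ _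
        (\sum_(0 <= i <oo) mu (Q `&` F @^-1` (grid_piece n U i)))%E).
      apply: measure_sigma_subadditive => [i||].
      - exact: measurableI.
      - by apply: measurableI => //; exact: minner.
      - by rewrite preimage_bigcup setI_bigcupr.
    rewrite [leRHS]eseries_mkcond; apply: lee_nneseries => // i _.
    rewrite in_setT /grid_piece; case: pickle_inv => [k|].
      by case: ifP => // _; rewrite preimage_set0 setI0 !measure0 mule0.
    by rewrite preimage_set0 setI0 !measure0 mule0.
  apply: lee_pmul => //; apply: area_le.
  - exact: pmeasurable_grid_inner.
  - exact: open_pmeasurable.
  - by move=> p /grid_innerP[k kp]; apply.
rewrite -[in leLHS](bigcup_grid_core oU) preimage_bigcup setI_bigcupr.
have mcore N : pmeasurable (Q `&` F @^-1` (grid_core U N)).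
  apply: measurableI => //; rewrite preimage_bigcap.
  by apply: bigcap_measurable => [|i _]; [exists N => /=|exact: minner].
apply: bigcup_le_area => // [a b ab|n].
  by apply/subsetPset; apply: setIS; apply: preimage_subset => p Up n nb;
    apply: Up; exact: leq_trans nb.
apply: le_trans (inner_le n); apply: area_le => //; first exact: measurableI.
by apply: setIS; apply: preimage_subset => p; apply => /=.
Qed.

End Covering.

(** * Hyperbolic functions and the complex sine *)

Section RealFunctions.
Variable R : realType.
Implicit Types x y u v p q r s : R.

Definition cosh x : R := (expR x + expR (- x)) / 2.
Definition sinh x : R := (expR x - expR (- x)) / 2.

Lemma expR_split x : expR x = cosh x + sinh x.
Proof. rewrite /cosh /sinh; lra. Qed.

Lemma expRN_split x : expR (- x) = cosh x - sinh x.
Proof. rewrite /cosh /sinh; lra. Qed.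

Lemma cosh2Bsinh2 x : cosh x ^+ 2 - sinh x ^+ 2 = 1.
Proof. by rewrite subr_sqr -expRN_split -expR_split mulrC expRxMexpNx_1. Qed.

Lemma coshN x : cosh (- x) = cosh x.
Proof. by rewrite /cosh opprK addrC. Qed.

Lemma sinhN x : sinh (- x) = - sinh x.
Proof. by rewrite /sinh opprK -mulNr opprB. Qed.

Lemma coshD x y : cosh (x + y) = cosh x * cosh y + sinh x * sinh y.
Proof.
rewrite {1}/cosh opprD !expRD expR_split (expR_split y) expRN_split (expRN_split y).
by field.
Qed.

Lemma sinhD x y : sinh (x + y) = sinh x * cosh y + cosh x * sinh y.
Proof.
rewrite {1}/sinh opprD !expRD expR_split (expR_split y) expRN_split (expRN_split y).
by field.
Qed.

Lemma cosh_gt0 x : 0 < cosh x.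
Proof. by rewrite /cosh divr_gt0// addr_gt0 ?expR_gt0. Qed.

Lemma ler_sinh x y : x <= y -> sinh x <= sinh y.
Proof.
move=> xy; have h : expR x <= expR y by rewrite ler_expR.
have h' : expR (- y) <= expR (- x) by rewrite ler_expR lerN2.
rewrite /sinh; lra.
Qed.

Lemma sinh0 : sinh 0 = 0.
Proof. by rewrite /sinh oppr0 subrr mul0r. Qed.

Lemma ge0_derive_ge0 (f df : R -> R) x : 0 <= x ->
  (forall y, is_derive y 1 f (df y)) -> (forall y, 0 <= y <= x -> 0 <= df y) ->
  f 0 <= f x.
Proof.
move=> x0 fdf df0.
have fc : {within `[0, x], continuous f}.
  by apply: derivable_within_continuous => y _; have [] := fdf y.
have [c] := MVT_segment x0 (fun y _ => fdf y) fc.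
rewrite in_itv/= subr0 => cx fE; rewrite -subr_ge0 fE mulr_ge0//; exact: df0.
Qed.

Lemma sinh_ge_id x : 0 <= x -> x <= sinh x.
Proof.
move=> x0; rewrite -subr_ge0.
have -> : 0 = sinh 0 - 0 by rewrite sinh0 subr0.
apply: (@ge0_derive_ge0 (fun y => sinh y - y) (fun y => cosh y - 1)) => // [y|y _].
  rewrite /sinh /cosh; apply: is_derive_eq.
  by rewrite /GRing.scale/=; field.
rewrite subr_ge0 -(ler_pXn2r (n := 2)) ?nnegrE ?(ltW (cosh_gt0 _))//.
by rewrite expr1n -subr_ge0 -[X in 0 <= _ - X](cosh2Bsinh2 y) opprB addrC subrK sqr_ge0.
Qed.

Lemma normr_sin_le x : 0 <= x -> `|sin x| <= x.
Proof.
move=> x0; rewrite ler_norml -[- x <= _]subr_ge0 opprK -[sin x <= x]subr_ge0.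
apply/andP; split.
  have -> : 0 = sin 0 + 0 :> R by rewrite sin0 addr0.
  apply: (@ge0_derive_ge0 (fun y => sin y + y) (fun y => cos y + 1)) => //.
have -> : 0 = 0 - sin 0 :> R by rewrite sin0 subr0.
apply: (@ge0_derive_ge0 (fun y => y - sin y) (fun y => 1 - cos y)) => //.
Qed.

Lemma cos_ge x : 0 <= x -> 1 - x ^+ 2 / 2 <= cos x.
Proof.
move=> x0; have h := normr_sin_le (divr_ge0 x0 (ler0n R 2)).
have {}h : sin (x / 2) ^+ 2 <= (x / 2) ^+ 2.
  by rewrite -real_normK ?num_real// lerXn2r ?nnegrE// divr_ge0.
rewrite [in leRHS](splitr x) -mulr2n cos_mulr2n cos2sin2; lra.
Qed.

Lemma sin_ge x : 0 <= x -> x - x ^+ 3 / 6 <= sin x.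
Proof.
move=> x0; rewrite -subr_ge0.
have -> : 0 = sin 0 - (0 - 0 ^+ 3 / 6) :> R by rewrite sin0 expr0n/= mul0r !subr0.
apply: (@ge0_derive_ge0 (fun y => sin y - (y - y ^+ 3 / 6))
  (fun y => cos y - (1 - y ^+ 2 / 2))) => // [y|y /andP[y0 _]].
  by apply: is_derive_eq; rewrite /GRing.scale/=; field.
by rewrite subr_ge0 cos_ge.
Qed.

(** On [0, 1] the Taylor bound gives sin x >= x - x^3/6 >= 5x/6, and 25/36 is the square of 5/6. *)
Lemma sin_sqr_ge x : `|x| <= 1 -> 25 / 36 * x ^+ 2 <= sin x ^+ 2.
Proof.
wlog x0 : x / 0 <= x.
  move=> H; have [/H//|x0] := leP 0 x; have := H (- x).
  by rewrite sinN !sqrrN normrN oppr_ge0; apply; exact: ltW.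
rewrite ger0_norm// => x1; have h := sin_ge x0.
have : 5 / 6 * x <= sin x by apply: le_trans h; nra.
move=> {}h; have h0 : 0 <= 5 / 6 * x by lra.
nra.
Qed.

Lemma sqr_le_sqrt x y : 0 <= x -> x ^+ 2 <= y -> x <= Num.sqrt y.
Proof. by move=> x0 xy; rewrite -(ger0_norm x0) -sqrtr_sqr ler_wsqrtr. Qed.

Lemma sinh_sqr_ge x : x ^+ 2 <= sinh x ^+ 2.
Proof.
wlog x0 : x / 0 <= x.
  move=> H; have [/H//|x0] := leP 0 x; have := H (- x).
  by rewrite sinhN !sqrrN oppr_ge0; apply; exact: ltW.
by rewrite lerXn2r ?nnegrE ?(le_trans _ (sinh_ge_id _))// sinh_ge_id.
Qed.

End RealFunctions.

Section ComplexSine.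
Variable R : realType.
Implicit Types (z w : R[i]).

Lemma cabs_ge0 z : 0 <= cabs z.
Proof. by case: z => x y; rewrite /cabs/= sqrtr_ge0. Qed.

Lemma sqr_cabs z : cabs z ^+ 2 = complex.Re z ^+ 2 + complex.Im z ^+ 2.
Proof. by case: z => x y; rewrite /cabs/= sqr_sqrtr// addr_ge0 ?sqr_ge0. Qed.

Lemma cabsM z w : cabs (z * w) = cabs z * cabs w.
Proof. exact: ComplexField.Normc.normcM. Qed.

Lemma cabsD z w : cabs (z + w) <= cabs z + cabs w.
Proof. exact: le_normcD. Qed.

Lemma cabsN z : cabs (- z) = cabs z.
Proof. exact: normcN. Qed.

Lemma cabsB z w : cabs z - cabs w <= cabs (z + w).
Proof. by rewrite lerBlDr -(cabsN w) -{1}(addrK w z) cabsD. Qed.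

Lemma cabs_gt0 z : z != 0 -> 0 < cabs z.
Proof.
move=> z0; rewrite lt_def cabs_ge0 andbT; apply: contra z0 => /eqP.
by move/ComplexField.Normc.eq0_normc => ->.
Qed.

Lemma normr_Im_le z : `|complex.Im z| <= cabs z.
Proof.
rewrite -(ler_pXn2r (n := 2))// ?nnegrE ?cabs_ge0// real_normK ?num_real//.
by rewrite sqr_cabs lerDr sqr_ge0.
Qed.

Lemma csinE (x y : R) : csin (x +i* y) = (sin x * cosh y) +i* (cos x * sinh y).
Proof.
rewrite /csin /cexp.
have -> : 'i%C * (x +i* y) = (- y) +i* x by simpc.
have -> : - (- y +i* x) = y +i* (- x) by simpc.
rewrite /= cosN sinN.
apply: (mulIf (x := 2 * 'i%C)).
  rewrite mulf_neq0 ?pnatr_eq0//; by rewrite eq_complex /= oner_eq0 andbF.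
rewrite mulfVK; last first.
  rewrite mulf_neq0 ?pnatr_eq0//; by rewrite eq_complex /= oner_eq0 andbF.
rewrite mulrA (mulrC _ 2) -!mulrA mulr_natl mulr2n.
simpc; rewrite /cosh /sinh; congr (_ +i* _); by field.
Qed.

Lemma sqr_cabs_csin z :
  cabs (csin z) ^+ 2 = sin (complex.Re z) ^+ 2 + sinh (complex.Im z) ^+ 2.
Proof.
case: z => x y; rewrite csinE sqr_cabs/= (exprMn _ (sin x)) (exprMn _ (cos x)).
have -> : cosh y ^+ 2 = 1 + sinh y ^+ 2 by have := cosh2Bsinh2 y; lra.
by rewrite sin2cos2; ring.
Qed.

Lemma sinh_le_cabs_csin z : sinh `|complex.Im z| <= cabs (csin z).
Proof.
have s0 := le_trans (normr_ge0 _) (sinh_ge_id (normr_ge0 (complex.Im z))).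
rewrite -(ler_pXn2r (n := 2)) ?nnegrE ?cabs_ge0//.
by rewrite sqr_cabs_csin; case: ler0P; rewrite ?sinhN ?sqrrN lerDr sqr_ge0.
Qed.

Lemma cabs_csin_le z : cabs (csin z) <= cosh (complex.Im z).
Proof.
rewrite -(ler_pXn2r (n := 2))// ?nnegrE ?cabs_ge0 ?(ltW (cosh_gt0 _))//.
rewrite sqr_cabs_csin; have := cosh2Bsinh2 (complex.Im z); have := sin2cos2 (complex.Re z).
by have := sqr_ge0 (cos (complex.Re z)); lra.
Qed.

(* sin z - sin w = 2 cos((z + w)/2) sin((z - w)/2), with the moduli of the two
   factors written out. *)
Lemma sqr_cabs_csinB (p q r s : R) :
  cabs (csin ((p + q) +i* (r + s)) - csin ((p - q) +i* (r - s))) ^+ 2 =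
  4 * (cos p ^+ 2 + sinh r ^+ 2) * (sin q ^+ 2 + sinh s ^+ 2).
Proof.
rewrite !csinE sqr_cabs/=.
rewrite sinD sinB cosD cosB !coshD !sinhD !coshN !sinhN.
have hr := cosh2Bsinh2 r; have hs := cosh2Bsinh2 s.
have hp := cos2Dsin2 p; have hq := cos2Dsin2 q.
have -> : cos p ^+ 2 + sinh r ^+ 2 =
    cos p ^+ 2 * cosh r ^+ 2 + sin p ^+ 2 * sinh r ^+ 2.
  have -> : sin p ^+ 2 = 1 - cos p ^+ 2 by lra.
  have -> : cosh r ^+ 2 = 1 + sinh r ^+ 2 by lra.
  ring.
have -> : sin q ^+ 2 + sinh s ^+ 2 =
    sin q ^+ 2 * cosh s ^+ 2 + cos q ^+ 2 * sinh s ^+ 2.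
  have -> : cos q ^+ 2 = 1 - sin q ^+ 2 by lra.
  have -> : cosh s ^+ 2 = 1 + sinh s ^+ 2 by lra.
  ring.
ring.
Qed.

(** In the product formula for sin z - sin w, the midpoint has height at least [Y] on the side
    chosen by the sign [e], so the cosine factor is at least [sinh Y]. The half-difference has real
    part at most 1 in modulus, so [sin_sqr_ge] and [sinh_sqr_ge] bound the other factor below. *)
Lemma csin_expanding z w (Y e : R) : 0 <= Y -> e = 1 \/ e = - 1 ->
  `|complex.Re z - complex.Re w| <= 2 ->
  Y <= e * complex.Im z -> Y <= e * complex.Im w ->
  25 / 36 * sinh Y ^+ 2 * cabs (z - w) ^+ 2 <= cabs (csin z - csin w) ^+ 2.
Proof.
move: z w => [x y] [x' y'] Y0 eE xx' yY y'Y; rewrite /= in xx' yY y'Y.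
set p := (x + x') / 2; set q := (x - x') / 2.
set r := (y + y') / 2; set s := (y - y') / 2.
have -> : x +i* y = (p + q) +i* (r + s) by congr (_ +i* _); rewrite /p /q /r /s; field.
have -> : x' +i* y' = (p - q) +i* (r - s) by congr (_ +i* _); rewrite /p /q /r /s; field.
rewrite sqr_cabs_csinB sqr_cabs/=.
have hq : 25 / 36 * q ^+ 2 <= sin q ^+ 2.
  by apply: sin_sqr_ge; rewrite /q normrM [`|2^-1|]ger0_norm ?invr_ge0//; lra.
have hs := sinh_sqr_ge s.
have hr : sinh Y ^+ 2 <= sinh r ^+ 2.
  have -> : sinh r ^+ 2 = sinh (e * r) ^+ 2.
    by case: eE => ->; rewrite ?mul1r ?mulN1r ?sinhN ?sqrrN.
  have sY : 0 <= sinh Y by apply: le_trans (sinh_ge_id _).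
  have : sinh Y <= sinh (e * r) by apply: ler_sinh; rewrite /r; lra.
  by move=> h; rewrite lerXn2r ?nnegrE// (le_trans sY).
have -> : p + q - (p - q) = 2 * q by ring.
have -> : r + s - (r - s) = 2 * s by ring.
have cp := sqr_ge0 (cos p); have Y2 := sqr_ge0 (sinh Y); have s2 := sqr_ge0 s.
apply: (@le_trans _ _ (4 * sinh Y ^+ 2 * (sin q ^+ 2 + sinh s ^+ 2))); last first.
  apply: ler_wpM2r; first by rewrite addr_ge0 ?sqr_ge0.
  lra.
by rewrite -subr_ge0; set a := sinh Y ^+ 2 in hr Y2 *; nra.
Qed.

End ComplexSine.

(** * Fast escape *)

Section Dynamics.
Variables (R : realType) (alpha beta : R[i]) (X : R).
Let f z : R[i] := alpha * csin (z + beta).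
Local Notation a := (cabs alpha).
Let height z : R := `|complex.Im (z + beta)|.

Hypothesis alpha0 : alpha != 0.
Hypothesis expX : 64 <= expR X.
Hypothesis betaX : 18 * cabs beta <= a * (expR X - 1).
Hypothesis alphaX : 200 <= a * expR (X / 2).

Let a0 : 0 < a. Proof. exact: cabs_gt0. Qed.

Let X0 : 0 < X.
Proof. by rewrite -expR_gt1; apply: lt_le_trans expX; rewrite ltr1n. Qed.

Lemma cabs_sine_ge z : X <= height z ->
  a / 4 * expR (height z) <= cabs (f z + beta).
Proof.
move=> Xz; apply: le_trans (cabsB _ _); rewrite /f cabsM.
have hX : expR X <= expR (height z) by rewrite ler_expR.
have hN : expR (- height z) <= 1 by rewrite -expR0 ler_expR oppr_le0 normr_ge0.
have h : a * ((expR (height z) - 1) / 2) <= a * cabs (csin (z + beta)).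
  rewrite ler_wpM2l ?(ltW a0)//; apply: le_trans (sinh_le_cabs_csin _).
  by rewrite /sinh -/(height z); lra.
have h1 : a * expR X <= a * expR (height z) by rewrite ler_wpM2l// ltW.
have h2 : a * 64 <= a * expR X by rewrite ler_wpM2l ?expX// ltW.
by have := a0; have := betaX; lra.
Qed.

Lemma cabs_sine_le z : cabs (f z + beta) <= a * cosh (height z) + cabs beta.
Proof.
apply: le_trans (cabsD _ _) _; rewrite lerD2r /f cabsM ler_wpM2l ?cabs_ge0//.
apply: le_trans (cabs_csin_le _) _; rewrite /height.
by case: ler0P => _; rewrite ?coshN.
Qed.

Lemma cosh_le_expR (x : R) : cosh x <= expR `|x|.
Proof.
suff H (y : R) : 0 <= y -> cosh y <= expR y.
  by case: (ler0P x) => h; [rewrite -coshN|]; apply: H; rewrite ?oppr_ge0 ?(ltW h).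
by move=> y0; have : expR (- y) <= expR y by [rewrite ler_expR; lra]; rewrite /cosh; lra.
Qed.

Lemma max_modulus_sine_bound (r : R) : 0 <= r ->
  0 <= max_modulus f r <= a * expR (r + cabs beta).
Proof.
move=> r0; set A := [set cabs (f z) | z in [set z | cabs z = r]].
have Aub : ubound A (a * expR (r + cabs beta)).
  move=> _ [z /= zr <-]; rewrite /f cabsM ler_wpM2l ?cabs_ge0//.
  apply: le_trans (cabs_csin_le _) _; apply: le_trans (cosh_le_expR _) _.
  by rewrite ler_expR -zr; apply: le_trans (normr_Im_le _) (cabsD _ _).
have Ar : A (cabs (f (r +i* 0))).
  by exists (r +i* 0) => //; rewrite /cabs/= expr0n addr0 sqrtr_sqr ger0_norm.
apply/andP; split; last by apply: ge_sup => //; eexists; exact: Ar.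
by apply: (le_trans (cabs_ge0 (f (r +i* 0)))); apply: ub_le_sup => //; eexists; exact: Aub.
Qed.

(* The set where [height z ^ 2 < |z + beta|] is thin, yet avoiding it keeps
   |f z| as large as exp(sqrt |z|), which is still enough for fast escape. *)
Lemma sine_fast_escaping z (R0 : R) : 0 < R0 -> X < height z ->
  (forall n, (forall m, (m <= n)%N -> X < height (iter m f z)) ->
    cabs (iter n.+1 f z + beta) <= height (iter n.+1 f z) ^+ 2) ->
  fast_escaping f R0 z.
Proof.
move=> R00 Xz Hz; pose t n := height (iter n f z).
have step n : (forall m, (m <= n)%N -> X < t m) -> a / 4 * expR (t n) <= t n.+1 ^+ 2.
  by move=> Xt; apply: le_trans (Hz n Xt); apply: cabs_sine_ge; exact/ltW/Xt.
have t_ge0 n : 0 <= t n by exact: normr_ge0.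
(* Split e^t as e^(X/2) e^(t - X/2): [alphaX] makes a/4 e^(X/2) at least 50, and t > X gives e^(t -
   X/2) >= e^(t/2) >= 1 + t^2/8, so the square of the next height exceeds 4 t^2. *)
have double n : (forall m, (m <= n)%N -> X < t m) -> 2 * t n <= t n.+1.
  move=> Xtm; have Xt := Xtm n (leqnn n); rewrite -(ler_pXn2r (n := 2))// ?nnegrE ?mulr_ge0//.
  apply: le_trans (step n Xtm).
  have -> : t n = X / 2 + (t n - X / 2) by ring.
  rewrite expRD mulrA.
  have h1 : 1 + (t n / 2) ^+ 2 / 2 <= expR (t n / 2).
    by apply: (expR_ge1Dxn 1); rewrite divr_ge0.
  have h2 : expR (t n / 2) <= expR (t n - X / 2) by rewrite ler_expR; lra.
  have h3 : 50 * expR (t n - X / 2) <= a / 4 * expR (X / 2) * expR (t n - X / 2).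
    by rewrite ler_wpM2r ?expR_ge0//; have := alphaX; lra.
  have := t_ge0 n; set s := t n in h1 h2 h3 *; nra.
(* [double] asks that all earlier heights exceed [X], hence the strong induction. The linear growth
   later supplies an arbitrarily large height. *)
have Xt n : X * n.+1%:R <= t n /\ X < t n.
  elim/ltn_ind: n => -[_|n IH]; first by rewrite mulr1; split => //; exact: ltW.
  have [IH1 IH2] := IH n (ltnSn n).
  have := double n (fun m mn => (IH m mn).2); have X0' := X0.
  rewrite -!natr1 in IH1 *; have n0 : 0 <= n%:R :> R by [].
  by move=> dn; split; [rewrite mulrDr mulr1; nra|lra].
(* [P] is chosen so that 2 M(s) <= P e^s for s >= 0. [C] is made large enough for (P + C)^2 <= a/4
   e^C, and its summand |beta| pays for passing from heights to moduli. *)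
pose P := 2 * (a * expR (cabs beta)).
have P0 : 0 <= P by rewrite !mulr_ge0 ?expR_ge0 ?cabs_ge0.
pose C := P + 1 + 384 / a + cabs beta.
have b0 := cabs_ge0 beta.
have aV0 : 0 < a^-1 by rewrite invr_gt0.
have C1 : 1 <= C by rewrite /C; lra.
have PC : P <= C by rewrite /C; lra.
have aC : 384 <= a * C.
  by rewrite -ler_pdivrMl// /C; lra.
have C0 : 0 <= C by lra.
(* Since P <= C, the left side is at most 4 C^2; and e^C >= C^4/24 together with a C >= 384 and C >=
   1 makes the right side at least 4 C^2. *)
have expC : (P + C) ^+ 2 <= a / 4 * expR C.
  have h := expR_ge1Dxn 3 C0.
  have {}h : C ^+ 4 / 24 <= expR C by apply: le_trans h; rewrite !factS fact0; lra.
  apply: (@le_trans _ _ (4 * C ^+ 2)); first by nra.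
  apply: (@le_trans _ _ (a / 4 * (C ^+ 4 / 24))); last by rewrite ler_wpM2l// divr_ge0// ltW.
  have -> : a / 4 * (C ^+ 4 / 24) = (a * C) * C * (C ^+ 2) / 96 by field.
  have C2 : 0 <= C ^+ 2 by exact: sqr_ge0.
  have : 384 <= a * C * C by nra.
  nra.
have [l tl] : exists l, 2 * R0 + C <= t l.
  exists (Num.truncn ((2 * R0 + C) / X)).
  apply: le_trans (Xt _).1; rewrite -ler_pdivrMl// mulrC.
  by apply/ltW/truncnS_gt.
exists l => n /=; pose M := iter n (max_modulus f) R0.
(* This invariant reproduces itself: the square of the next height is at least a/4 e^C e^(2M) >= ((P
   + C) e^M)^2. The factor 2 in front of [M] compensates for the square root. *)
suff: 0 <= M /\ 2 * M + C <= t (n + l)%N.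
  rewrite -/M => -[M0 MC].
  have h1 := normr_Im_le (iter (n + l) f z).
  have h2 : t (n + l)%N <= `|complex.Im (iter (n + l) f z)| + cabs beta.
    rewrite /t /height raddfD/=; apply: le_trans (ler_normD _ _) _.
    by rewrite lerD2l normr_Im_le.
  have : cabs beta <= C by rewrite /C; lra.
  lra.
rewrite {}/M; elim: n => [|n [M0 IH]]; first by split => //; exact: ltW.
rewrite addSn iterS; set M := iter n _ _ in M0 IH *.
have /andP[M'0 M'le] := max_modulus_sine_bound M0; split => //.
have e1 : 1 <= expR M by rewrite -expR0 ler_expR.
apply: (@le_trans _ _ ((P + C) * expR M)).
  rewrite [leRHS]mulrDl; apply: lerD; last by rewrite ler_peMr.
  by rewrite /P -!mulrA ler_wpM2l// -expRD [_ beta + _]addrC.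
have PC0 : 0 <= P + C by lra.
rewrite -(ler_pXn2r (n := 2)) ?nnegrE ?mulr_ge0 ?expR_ge0//.
apply: le_trans (step _ (fun m _ => (Xt m).2)); rewrite exprMn.
apply: (@le_trans _ _ (a / 4 * expR C * expR M ^+ 2)).
  by rewrite ler_wpM2r// sqr_ge0.
rewrite -!mulrA -expRM_natl -expRD ler_wpM2l ?(ltW a0)//.
by rewrite ler_wpM2l// ler_expR addrC.
Qed.

End Dynamics.

(** * The iterated preimages of the thin set *)

Section PlanarContinuity.
Variable R : realType.
Implicit Types g k : R * R -> R.

Lemma continuous_prodfun g k :
  continuous g -> continuous k -> continuous (fun p => (g p, k p)).
Proof. by move=> cg ck p; exact: (cvg_pair (cg p) (ck p)). Qed.

Lemma continuous_mulfun g k :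
  continuous g -> continuous k -> continuous (fun p => g p * k p).
Proof. by move=> cg ck p; apply: cvgM; [exact: cg|exact: ck]. Qed.

Lemma continuous_addfun g k :
  continuous g -> continuous k -> continuous (fun p => g p + k p).
Proof. by move=> cg ck p; apply: cvgD; [exact: cg|exact: ck]. Qed.

Lemma continuous_subfun g k :
  continuous g -> continuous k -> continuous (fun p => g p - k p).
Proof. by move=> cg ck p; apply: cvgB; [exact: cg|exact: ck]. Qed.

Lemma continuous_cstfun (c : R) : continuous (fun _ : R * R => c).
Proof. by move=> p; exact: cvg_cst. Qed.

Lemma continuous_compfun g (h : R -> R) :
  continuous h -> continuous g -> continuous (fun p => h (g p)).
Proof. by move=> ch cg p; apply: continuous_comp; [exact: cg|exact: ch]. Qed.

Lemma continuous_expfun g n : continuous g -> continuous (fun p => g p ^+ n).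
Proof.
move=> cg; apply: (continuous_compfun (h := fun x => x ^+ n)) => //.
exact: exprn_continuous.
Qed.

Lemma continuous_xshift (c : R) : continuous (fun p : R * R => p.1 + c).
Proof.
by apply: continuous_addfun; [move=> p; exact: cvg_fst|exact: continuous_cstfun].
Qed.

Lemma continuous_yshift (c : R) : continuous (fun p : R * R => p.2 + c).
Proof.
by apply: continuous_addfun; [move=> p; exact: cvg_snd|exact: continuous_cstfun].
Qed.

Lemma continuous_cosh : continuous (@cosh R).
Proof.
move=> x; apply: cvgM; last exact: cvg_cst.
apply: cvgD; first exact: continuous_expR.
by apply: continuous_comp; [exact: opp_continuous|exact: continuous_expR].
Qed.

Lemma continuous_sinh : continuous (@sinh R).
Proof.
move=> x; apply: cvgM; last exact: cvg_cst.
apply: cvgB; first exact: continuous_expR.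
by apply: continuous_comp; [exact: opp_continuous|exact: continuous_expR].
Qed.

Lemma open_lt_continuous g k : continuous g -> continuous k ->
  open [set p | g p < k p].
Proof.
move=> cg ck; have -> : [set p | g p < k p] = (fun p => k p - g p) @^-1` [set x | 0 < x].
  by apply/seteqP; split => p /=; rewrite subr_gt0.
by move/continuousP : (continuous_subfun ck cg); apply; exact: open_gt.
Qed.

End PlanarContinuity.

(** * The map in real coordinates and its bad sets *)

Section BadSets.
Variables (R : realType) (alpha beta : R[i]) (X : R).
Implicit Types (p q : R * R) (W : set (R * R)).
Let f z : R[i] := alpha * csin (z + beta).
Local Notation a := (cabs alpha).
Local Notation b1 := (complex.Re beta).
Local Notation b2 := (complex.Im beta).
Local Notation mu := (@lebesgue_measure R \x @lebesgue_measure R)%E.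
Local Notation pmeasurable A :=
  (measurable (A : set (measurableTypeR R * measurableTypeR R))).

(** The map [f] in real coordinates, where the product measure lives; [s] and [c] are the real and
    imaginary parts of sin(z + beta). *)
Definition planar_sine p : R * R :=
  let s := sin (p.1 + b1) * cosh (p.2 + b2) in
  let c := cos (p.1 + b1) * sinh (p.2 + b2) in
  (complex.Re alpha * s - complex.Im alpha * c,
   complex.Re alpha * c + complex.Im alpha * s).

Definition toC p : R[i] := p.1 +i* p.2.

Lemma Im_toC_shift p : complex.Im (toC p + beta) = p.2 + b2.
Proof. by case: (beta). Qed.

Lemma toC_planar_sine p : toC (planar_sine p) = f (toC p).
Proof.
have E : toC p + beta = (p.1 + b1) +i* (p.2 + b2) by case: (beta).
by rewrite /f E csinE /planar_sine; case: (alpha).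
Qed.

Lemma continuous_planar_sine : continuous planar_sine.
Proof.
have cs : continuous (fun p : R * R => sin (p.1 + b1) * cosh (p.2 + b2)).
  apply: continuous_mulfun; apply: continuous_compfun.
  - exact: continuous_sin.
  - exact: continuous_xshift.
  - exact: continuous_cosh.
  - exact: continuous_yshift.
have cc : continuous (fun p : R * R => cos (p.1 + b1) * sinh (p.2 + b2)).
  apply: continuous_mulfun; apply: continuous_compfun.
  - exact: continuous_cos.
  - exact: continuous_xshift.
  - exact: continuous_sinh.
  - exact: continuous_yshift.
by apply: continuous_prodfun; [apply: continuous_subfun|apply: continuous_addfun];
  apply: continuous_mulfun => //; exact: continuous_cstfun.
Qed.

Definition offset_sqnorm p : R := (p.1 + b1) ^+ 2 + (p.2 + b2) ^+ 2.

Lemma offset_sqnormE p : offset_sqnorm p = cabs (toC p + beta) ^+ 2.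
Proof. by rewrite sqr_cabs /offset_sqnorm; case: (beta). Qed.

Lemma continuous_offset_sqnorm : continuous offset_sqnorm.
Proof.
apply: (continuous_addfun (g := fun p => (p.1 + b1) ^+ 2)
  (k := fun p => (p.2 + b2) ^+ 2)); apply: continuous_expfun.
- exact: continuous_xshift.
- exact: continuous_yshift.
Qed.

(** This is (Im w)^2 < |w| for w = z + beta, squared so that both sides are polynomials and openness
    follows from continuity. *)
Definition thin_set : set (R * R) := [set p | (p.2 + b2) ^+ 4 < offset_sqnorm p].

Lemma open_thin_set : open thin_set.
Proof.
apply: open_lt_continuous; last exact: continuous_offset_sqnorm.
by apply: continuous_expfun; exact: continuous_yshift.
Qed.

(** For some k between 1 and [n], the orbit has height above [X] at the times 0, ..., k - 1 and lies
    in the thin set at time k. *)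
Fixpoint bad_set n : set (R * R) :=
  if n is n'.+1 then
    [set p | X < `|p.2 + b2|] `&` planar_sine @^-1` (thin_set `|` bad_set n')
  else set0.

Lemma open_bad_set n : open (bad_set n).
Proof.
elim: n => [|n IH]; first exact: open0.
apply: openI.
  apply: open_lt_continuous; first exact: continuous_cstfun.
  by apply: (continuous_compfun (h := Num.norm)); [exact: norm_continuous|exact: continuous_yshift].
have /continuousP := continuous_planar_sine; apply.
by apply: openU => //; exact: open_thin_set.
Qed.

Lemma nondecreasing_bad_set : nondecreasing_seq bad_set.
Proof.
apply/nondecreasing_seqP => n; apply/subsetPset.
elim: n => [|n IH]; first exact: sub0set.
by apply: setIS; apply: preimage_subset; apply: setUS.
Qed.

End BadSets.

(** * The uniform area bound 5/2 for the bad sets in a strip *)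

Section BadSetArea.
Variables (R : realType) (alpha beta : R[i]) (X : R).
Implicit Types (p q : R * R) (W : set (R * R)).
Local Notation a := (cabs alpha).
Local Notation b1 := (complex.Re beta).
Local Notation b2 := (complex.Im beta).
Local Notation mu := (@lebesgue_measure R \x @lebesgue_measure R)%E.
Local Notation pmeasurable A :=
  (measurable (A : set (measurableTypeR R * measurableTypeR R))).
Local Notation F := (planar_sine alpha beta).
Local Notation V := (bad_set alpha beta X).
Local Notation D := (thin_set beta).

Hypothesis alpha0 : alpha != 0.
Hypothesis expX : 64 <= expR X.
Hypothesis betaX : 18 * cabs beta <= a * (expR X - 1).
Hypothesis alphaX : 1120 ^+ 2 <= a * expR X.

Let a0 : 0 < a. Proof. exact: cabs_gt0. Qed.

Definition strip (s : R) : set (R * R) := [set p | s <= p.1 <= s + 2 * pi].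

Lemma pmeasurable_strip s : pmeasurable (strip s).
Proof.
have := @measurable_itv R `[s, s + 2 * pi]%O.
have cf : continuous (@fst R R) by move=> p; exact: cvg_fst.
by move=> /(continuous_pmeasurable cf); congr (measurable _).
Qed.

Lemma finite_cover_area (G : nat -> set (R * R)) A n (c : R) :
  pmeasurable A -> (forall k, pmeasurable (G k)) ->
  A `<=` \bigcup_(k < n) G k -> (forall k, (mu (G k) <= c%:E)%E) ->
  (mu A <= (n%:R * c)%:E)%E.
Proof.
move=> mA mG AG Gc; apply: (@le_trans _ _ (\sum_(k < n) mu (G k))%E).
  by apply: content_subadditive => //; rewrite -bigcup_mkord.
apply: (@le_trans _ _ (\sum_(k < n) c%:E)%E); first exact: lee_sum.
by rewrite sumEFin lee_fin sumr_const card_ord mulr_natl.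
Qed.

(** Since e^Y >= 64, sinh Y >= (63/128) e^Y, and (25/36) (63/128)^2 exceeds 4/25. *)
Lemma planar_sine_expanding (Y e x0 : R) p q : 64 <= expR Y -> e = 1 \/ e = -1 ->
  x0 <= p.1 <= x0 + 2 -> x0 <= q.1 <= x0 + 2 ->
  Y <= e * (p.2 + b2) -> Y <= e * (q.2 + b2) ->
  4 / 25 * (a * expR Y) ^+ 2 * sqnorm (p - q) <= sqnorm (F p - F q).
Proof.
move=> LY eE /andP[p1 p2] /andP[q1 q2] pY qY.
have Y0 : 0 <= Y by apply/ltW; rewrite -expR_gt1; apply: lt_le_trans LY; rewrite ltr1n.
have ReE r : complex.Re (toC r + beta) = r.1 + b1 by case: (beta).
have sqE r s : sqnorm (r - s) = cabs (toC r - toC s) ^+ 2 by rewrite sqr_cabs.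
rewrite !sqE !toC_planar_sine -mulrBr cabsM (exprMn _ a (cabs _)).
have := @csin_expanding R (toC p + beta) (toC q + beta) Y e Y0 eE.
rewrite !ReE !Im_toC_shift => /(_ _ pY qY).
rewrite [X in cabs X ^+ 2](_ : _ = toC p - toC q); last by ring.
rewrite [in X in X -> _](_ : p.1 + b1 - (q.1 + b1) = p.1 - q.1); last by ring.
rewrite ler_norml => /(_ _)/(le_trans _) H.
set N := cabs _ ^+ 2 in H *.
have -> : 4 / 25 * (a * expR Y) ^+ 2 * N = a ^+ 2 * (4 / 25 * expR Y ^+ 2 * N) by ring.
rewrite ler_wpM2l ?sqr_ge0//; apply: H; last by apply/andP; split; lra.
rewrite ler_wpM2r ?sqr_ge0//.
have h : expR (- Y) <= 1 by rewrite -expR0 ler_expR oppr_le0.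
have hs : 63 / 128 * expR Y <= sinh Y by rewrite /sinh; lra.
have L0 := expR_ge0 Y; nra.
Qed.

(** Up to height Y + ln 4, cosh is at most 2 e^Y + 1/2. The remaining summands a/2 and |beta| are
    small multiples of a e^Y by [expX] and [betaX], and fit into the gap between 2 and 9/4. *)
Lemma planar_sine_image (Y : R) p : X <= Y -> Y <= `|p.2 + b2| <= Y + ln 4 ->
  offset_sqnorm beta (F p) < (9 / 4 * (a * expR Y)) ^+ 2.
Proof.
move=> XY /andP[Yp pY].
have hXY : expR X <= expR Y by rewrite ler_expR.
rewrite offset_sqnormE toC_planar_sine ltrXn2r ?nnegrE ?cabs_ge0//.
apply: le_lt_trans (cabs_sine_le _ _ _) _.
rewrite Im_toC_shift; set t := `|_| in Yp pY *.
have h1 : expR t <= expR Y * 4 by rewrite -[4]lnK ?posrE// -expRD ler_expR.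
have h2 : expR (- t) <= 1 by rewrite -expR0 ler_expR oppr_le0; exact: normr_ge0.
have h3 : cosh t <= 2 * expR Y + 2^-1 by rewrite /cosh; lra.
have h4 : a * cosh t <= a * (2 * expR Y + 2^-1) by rewrite ler_wpM2l// ltW.
have h5 : a * expR X <= a * expR Y by rewrite ler_wpM2l// ltW.
have h6 : a * 64 <= a * expR X by rewrite ler_wpM2l// ltW.
by have := betaX; have := a0; lra.
Qed.

(** Width 2 and a single side, [e = 1] or [e = -1], meet the requirements of [csin_expanding]. The
    band height ln 4 makes the square root of a e^Y double from one band to the next. *)
Definition piece (Y e x0 : R) : set (R * R) :=
  [set p | [/\ x0 <= p.1 <= x0 + 2, Y <= e * (p.2 + b2) & `|p.2 + b2| <= Y + ln 4]].

Lemma pmeasurable_piece (Y e x0 : R) : pmeasurable (piece Y e x0).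
Proof.
have cx : continuous (fun p : R * R => p.1) by move=> p; exact: cvg_fst.
have cy := @continuous_yshift R b2.
have m1 := continuous_pmeasurable cx (@measurable_itv R `[x0, x0 + 2]%O).
have ce : continuous (fun p : R * R => e * (p.2 + b2)).
  by apply: continuous_mulfun => //; exact: continuous_cstfun.
have m2 := continuous_pmeasurable ce (@measurable_itv R `[Y, +oo[%O).
have cn : continuous (fun p : R * R => `|p.2 + b2|).
  by apply: (continuous_compfun (h := Num.norm)); [exact: norm_continuous|].
have m3 := continuous_pmeasurable cn (@measurable_itv R `]-oo, Y + ln 4]%O).
have := measurableI _ _ (measurableI _ _ m1 m2) m3.
congr (measurable _); apply/seteqP; split => p /=; rewrite !in_itv/= andbT.
  by move=> [[]].
by move=> [].
Qed.

Definition level (s Y : R) : set (R * R) :=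
  strip s `&` [set p | Y <= `|p.2 + b2| <= Y + ln 4].

Lemma pmeasurable_level s Y : pmeasurable (level s Y).
Proof.
apply: measurableI; first exact: pmeasurable_strip.
have cn : continuous (fun p : R * R => `|p.2 + b2|).
  apply: (continuous_compfun (h := Num.norm)); first exact: norm_continuous.
  exact: continuous_yshift.
have := continuous_pmeasurable cn (@measurable_itv R `[Y, Y + ln 4]%O).
by congr (measurable _).
Qed.

Section Step.
Variable n : nat.
Hypothesis IH : forall s, (mu (strip s `&` V n) <= (5 / 2)%:E)%E.

Let mV : pmeasurable (V n). Proof. by apply: open_pmeasurable; exact: open_bad_set. Qed.

(** Here h^2 stands for a e^Y. The thin part lies in a rectangle with half-sides 9/4 h^2 and 3/2 h,
    of area 27/2 h^3. The bad part is covered by O(h^2) strips, each contributing at most 5/2 by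
    [IH]; for h >= 1120 this fits into the remaining h^3/2. *)
Lemma target_disc_area (h : R) : 1120 <= h ->
  (mu ((D `|` V n) `&` [set p | (offset_sqnorm beta p < (9 / 4 * h ^+ 2) ^+ 2)%R]) <=
    (14 * h ^+ 3)%:E)%E.
Proof.
move=> h1; have h0 : 0 <= h by lra.
set rho := 9 / 4 * h ^+ 2; set B := [set p | _].
have rho0 : 0 <= rho by rewrite mulr_ge0 ?sqr_ge0//; lra.
have mB : pmeasurable B.
  apply: open_pmeasurable; apply: open_lt_continuous.
    exact: continuous_offset_sqnorm.
  exact: continuous_cstfun.
have mD : pmeasurable D by apply: open_pmeasurable; exact: open_thin_set.
have Bx p : B p -> `|p.1 + b1| <= rho.
  move=> /ltW Bp; rewrite -(ler_pXn2r (n := 2)) ?nnegrE// real_normK ?num_real//.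
  by apply: le_trans Bp; rewrite lerDl sqr_ge0.
have DB : (mu (D `&` B) <= (27 / 2 * h ^+ 3)%:E)%E.
  apply: (@le_trans _ _ (mu (`[- b1 - rho, - b1 + rho]%classic `*`
      `[- b2 - 3 / 2 * h, - b2 + 3 / 2 * h]%classic))).
    apply: area_le; [exact: measurableI|exact: pmeasurable_rect|].
    move=> p [Dp Bp]; have := Bx p Bp; rewrite ler_norml => /andP[x1 x2].
    have : `|p.2 + b2| <= 3 / 2 * h.
      rewrite -(ler_pXn2r (n := 4)) ?nnegrE//; last lra.
      have -> : (3 / 2 * h) ^+ 4 = rho ^+ 2 by rewrite /rho; field.
      rewrite -[4%N]/(2 * 2)%N exprM real_normK ?num_real// -exprM.
      by apply/ltW; exact: lt_trans Dp Bp.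
    rewrite ler_norml => /andP[y1 y2]; split => /=; rewrite in_itv/=;
    by apply/andP; split; lra.
  rewrite area_rect; [|lra|lra].
  by rewrite lee_fin /rho le_eqVlt; apply/orP; left; apply/eqP; field.
have VB : (mu (V n `&` B) <= ((9 / 8 * h ^+ 2 + 1) * (5 / 2))%:E)%E.
  (* A strip has width 2 pi >= 4, so [N] adjacent strips starting at the left end cover the
     horizontal extent 2 rho = 9/2 h^2 of the disc. *)
  pose N := (Num.truncn (9 / 8 * h ^+ 2)).+1.
  have NE : N%:R <= 9 / 8 * h ^+ 2 + 1.
    by rewrite /N -natr1 lerD2r truncn_le// mulr_ge0 ?sqr_ge0//; lra.
  apply: (@le_trans _ _ (N%:R * (5 / 2))%:E); last by rewrite lee_fin ler_wpM2r//; lra.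
  pose s k : R := - b1 - rho + k%:R * (2 * pi).
  apply: (@finite_cover_area (fun k => strip (s k) `&` V n)).
  - exact: measurableI.
  - by move=> k; apply: measurableI => //; exact: pmeasurable_strip.
  - move=> p [Vp Bp]; have := Bx p Bp; rewrite ler_norml => /andP[x1 x2].
    have pi2 := pi_ge2 R.
    have tpi : 0 < 2 * pi :> R by lra.
    set u := (p.1 + b1 + rho) / (2 * pi).
    have u0 : 0 <= u by rewrite divr_ge0//; lra.
    have uE : u * (2 * pi) = p.1 + b1 + rho by rewrite divfK// gt_eqF.
    have /andP[k1 k2] := truncn_itv u0.
    exists (Num.truncn u) => /=.
      rewrite /N ltnS le_truncn// ler_pdivrMr//.
      have := sqr_ge0 h; move: x2; rewrite /rho; nra.
    split => //; rewrite /strip /s/=.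
    have K1 : (Num.truncn u)%:R * (2 * pi) <= u * (2 * pi) by rewrite ler_wpM2r// ltW.
    have K2 : u * (2 * pi) <= (Num.truncn u).+1%:R * (2 * pi) by rewrite ler_wpM2r// ltW.
    rewrite -natr1 mulrDl in K2.
    by apply/andP; split; lra.
  - by move=> k; exact: IH.
rewrite setIUl; apply: (@le_trans _ _ (mu (D `&` B) + mu (V n `&` B))%E).
  by apply: measureU2; exact: measurableI.
apply: le_trans (leeD DB VB) _; rewrite -EFinD lee_fin.
have h2 : 1120 * h <= h ^+ 2 by rewrite expr2 ler_wpM2r.
have h3 : 1120 * h ^+ 2 <= h ^+ 3 by rewrite exprS ler_wpM2r ?sqr_ge0.
lra.
Qed.

(** The expansion factor is m = 4/25 h^4, and 2/m times the target area 14 h^3 equals 175/h. *)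
Lemma piece_area (Y e x0 : R) : X <= Y -> e = 1 \/ e = -1 ->
  (mu (piece Y e x0 `&` F @^-1` (D `|` V n)) <=
    (175 / Num.sqrt (a * expR Y))%:E)%E.
Proof.
move=> XY eE; set h := Num.sqrt (a * expR Y).
have hXY : expR X <= expR Y by rewrite ler_expR.
have L64 : 64 <= expR Y by exact: le_trans hXY.
have aL0 : 0 <= a * expR Y by rewrite mulr_ge0 ?expR_ge0 ?cabs_ge0.
have hE : h ^+ 2 = a * expR Y by rewrite sqr_sqrtr.
have h1 : 1120 <= h.
  apply: sqr_le_sqrt; first exact: ler0n.
  by apply: (le_trans alphaX); rewrite ler_wpM2l// ltW.
set Q := piece Y e x0; set B := [set p | offset_sqnorm beta p < (9 / 4 * h ^+ 2) ^+ 2].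
have mQ : pmeasurable Q by exact: pmeasurable_piece.
have oB : open B.
  apply: open_lt_continuous; first exact: continuous_offset_sqnorm.
  exact: continuous_cstfun.
have oW : open ((D `|` V n) `&` B).
  by apply: openI => //; apply: openU; [exact: open_thin_set|exact: open_bad_set].
have Yabs p : Q p -> Y <= `|p.2 + b2|.
  move=> [_ Yp _]; apply: le_trans Yp _; case: eE => ->; rewrite ?mul1r ?mulN1r ?ler_norm//.
  by rewrite -normrN ler_norm.
(* By [planar_sine_image] the piece is mapped into the disc, so only the part of the target inside
   it counts. *)
have -> : Q `&` F @^-1` (D `|` V n) = Q `&` F @^-1` ((D `|` V n) `&` B).
  apply/seteqP; split => p [Qp Fp]; split => //; last exact: Fp.1.
  split => //; rewrite /B/= hE; apply: planar_sine_image XY _.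
  by rewrite Yabs//; case: Qp.
have m0 : 0 < 4 / 25 * (a * expR Y) ^+ 2.
  by rewrite mulr_gt0// ?exprn_gt0// mulr_gt0// expR_gt0.
have := @area_preimage_expanding R Q _ F _ m0 mQ (@continuous_planar_sine _ _ _) oW.
have Qexp p q : Q p -> Q q ->
    4 / 25 * (a * expR Y) ^+ 2 * sqnorm (p - q) <= sqnorm (F p - F q).
  move=> [xp yp _] [xq yq _]; exact: planar_sine_expanding xp xq yp yq.
move=> /(_ Qexp)/le_trans; apply.
apply: (@le_trans _ _ ((2 / (4 / 25 * (a * expR Y) ^+ 2))%:E * (14 * h ^+ 3)%:E)%E).
  apply: lee_pmul => //; last exact: target_disc_area.
  by rewrite lee_fin divr_ge0// ltW.
rewrite -EFinM lee_fin -hE le_eqVlt; apply/orP; left; apply/eqP.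
have hN0 : h != 0 by rewrite gt_eqF//; lra.
by field.
Qed.

Let mW : pmeasurable (F @^-1` (D `|` V n)).
Proof.
apply: open_pmeasurable; have /continuousP := @continuous_planar_sine R alpha beta; apply.
by apply: openU; [exact: open_thin_set|exact: open_bad_set].
Qed.

(** Four windows of width 2 cover a strip because 2 pi < 8, and each is taken on both sides. The
    covering index encodes both choices: its parity gives the sign and its half gives the window. *)
Lemma level_area (Y s : R) : X <= Y ->
  (mu (level s Y `&` F @^-1` (D `|` V n)) <=
    (8 * (175 / Num.sqrt (a * expR Y)))%:E)%E.
Proof.
move=> XY; apply: (@finite_cover_area (fun k =>
  piece Y ((-1) ^+ k) (s + k./2%:R * 2) `&` F @^-1` (D `|` V n))).
- by apply: measurableI => //; exact: pmeasurable_level.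
- by move=> k; apply: measurableI => //; exact: pmeasurable_piece.
- move=> p [[/andP[s1 s2] /andP[y1 y2]] Fp].
  set u := (p.1 - s) / 2.
  have u0 : 0 <= u by rewrite /u; lra.
  have /andP[k1 k2] := truncn_itv u0; rewrite -natr1 in k2.
  have kE (b : bool) : (b + (Num.truncn u).*2)./2 = Num.truncn u.
    by case: b; rewrite ?add0n ?doubleK// add1n /= uphalf_double.
  have uN4 : (Num.truncn u < 4)%N.
    rewrite -(ltr_nat R); apply: le_lt_trans k1 _; rewrite /u.
    by have := pihalf_lt2 R; lra.
  pose b := p.2 + b2 < 0.
  exists (b + (Num.truncn u).*2)%N => /=.
    by rewrite -[8%N]/(1 + 7)%N; case: (b) uN4; case: (Num.truncn u) => [|[|[|[|]]]].
  split => //; rewrite /piece/= kE; split => //.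
    by apply/andP; split; rewrite /u in k1 k2 *; lra.
  rewrite exprD -muln2 mulnC exprM sqrrN expr1n expr1n mulr1.
  move: y1; rewrite /b; case: (ltP (p.2 + b2) 0) => h.
    by rewrite ltr0_norm// expr1 mulN1r.
  by rewrite ger0_norm// expr0 mul1r.
- move=> k; apply: piece_area => //; rewrite -signr_odd.
  by case: odd; [right; rewrite expr1|left; rewrite expr0].
Qed.

(** Band j contributes at most 8 * 175 / (1120 * 2^j) = (5/4) / 2^j, and these bounds sum to 5/2,
    the constant assumed in [IH]. The threshold 1120 in [alphaX] is what closes this loop. *)
Lemma bad_set_area_step s : (mu (strip s `&` V n.+1) <= (5 / 2)%:E)%E.
Proof.
have l4 : 0 < ln 4 :> R by rewrite ln_gt0// ltr1n.
pose Y j : R := X + j%:R * ln 4.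
have XY j : X <= Y j by rewrite lerDl mulr_ge0// ltW.
have mV1 : pmeasurable (V n.+1) by apply: open_pmeasurable; exact: open_bad_set.
apply: (@le_trans _ _
    (\sum_(0 <= j <oo) mu (level s (Y j) `&` F @^-1` (D `|` V n)))%E).
  apply: measure_sigma_subadditive.
  - by move=> j; apply: measurableI => //; exact: pmeasurable_level.
  - by apply: measurableI => //; exact: pmeasurable_strip.
  - move=> p [sp [/= Xp Fp]].
    set u := (`|p.2 + b2| - X) / ln 4.
    have u0 : 0 <= u by apply: divr_ge0; [rewrite subr_ge0|]; exact: ltW.
    have uE : u * ln 4 = `|p.2 + b2| - X by rewrite divfK// gt_eqF.
    have /andP[k1 k2] := truncn_itv u0; rewrite -natr1 in k2.
    exists (Num.truncn u) => //; split => //; split => //=.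
    have K1 : (Num.truncn u)%:R * ln 4 <= u * ln 4 by rewrite ler_wpM2r// ltW.
    have K2 : u * ln 4 <= ((Num.truncn u)%:R + 1) * ln 4 by rewrite ler_wpM2r// ltW.
    by rewrite mulrDl in K2; rewrite /Y; apply/andP; split; lra.
apply: (@le_trans _ _ (\sum_(0 <= j <oo) ((5 / 2) / (2 ^ j.+1)%:R)%:E)%E); last first.
  by apply: epsilon_trick0; lra.
apply: lee_nneseries => // j _; apply: le_trans (level_area s (XY j)) _.
rewrite lee_fin.
have : 1120 * 2 ^+ j <= Num.sqrt (a * expR (Y j)).
  apply: sqr_le_sqrt; first by rewrite mulr_ge0 ?exprn_ge0 ?ler0n.
  rewrite exprMn expRD mulrA expRM_natl lnK ?posrE//.
  have -> : (2 ^+ j) ^+ 2 = 4 ^+ j :> R.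
    by rewrite -exprM mulnC exprM; congr (_ ^+ _); rewrite expr2 -natrM.
  by apply: ler_wpM2r; [rewrite exprn_ge0|exact: alphaX].
set h := Num.sqrt _; rewrite natrX exprS.
have : 0 < 2 ^+ j :> R by rewrite exprn_gt0.
set w := 2 ^+ j => w0 wh.
have h0 : 0 < h by lra.
have -> : 8 * (175 / h) = 1400 / h by field; rewrite gt_eqF.
have -> : 5 / 2 / (2 * w) = 1400 / (1120 * w) by field; rewrite gt_eqF.
apply: ler_wpM2l; first exact: ler0n.
by rewrite lef_pV2// posrE; lra.
Qed.

End Step.

Lemma bad_set_area n s : (mu (strip s `&` V n) <= (5 / 2)%:E)%E.
Proof.
elim: n s => [|n IH] s; first by rewrite setI0 measure0 lee_fin; lra.
exact: bad_set_area_step.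
Qed.

Lemma bad_union_area s : (mu (strip s `&` \bigcup_n V n) <= (5 / 2)%:E)%E.
Proof.
rewrite setI_bigcupr; apply: bigcup_le_area => [n|m n mn|n].
- apply: measurableI; first exact: pmeasurable_strip.
  by apply: open_pmeasurable; exact: open_bad_set.
- by apply/subsetPset; apply: setIS; apply/subsetPset; exact: nondecreasing_bad_set.
- exact: bad_set_area.
Qed.

End BadSetArea.

(** * The area estimate *)

Section SineArea.
Variables (R : realType) (alpha beta : R[i]) (X : R).
Implicit Types (p q : R * R).
Let f z : R[i] := alpha * csin (z + beta).
Local Notation a := (cabs alpha).
Local Notation b2 := (complex.Im beta).
Local Notation mu := (@lebesgue_measure R \x @lebesgue_measure R)%E.
Local Notation pmeasurable A :=
  (measurable (A : set (measurableTypeR R * measurableTypeR R))).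
Local Notation F := (planar_sine alpha beta).
Local Notation V := (bad_set alpha beta X).

Hypothesis alpha0 : alpha != 0.
Hypothesis expX : 64 <= expR X.
Hypothesis betaX : 18 * cabs beta <= a * (expR X - 1).
Hypothesis alphaX : 1120 ^+ 2 <= a * expR X.
Hypothesis alphaX2 : 200 <= a * expR (X / 2).

Lemma toC_iter n p : toC (iter n F p) = iter n f (toC p).
Proof. by elim: n => //= n <-; rewrite toC_planar_sine. Qed.

Lemma pmeasurable_fast_escaping (R0 : R) :
  pmeasurable [set p | fast_escaping f R0 (toC p)].
Proof.
have ci n : continuous (iter n F).
  elim: n => [|n IH] p; first exact: cvg_id.
  by apply: continuous_comp; [exact: IH|exact: continuous_planar_sine].
have cs : continuous (@sqnorm R).
  apply: (continuous_addfun (g := fun p => p.1 ^+ 2) (k := fun p => p.2 ^+ 2));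
    apply: continuous_expfun => p; [exact: cvg_fst|exact: cvg_snd].
have cc n : continuous (fun p => cabs (iter n f (toC p))).
  have -> : (fun p => cabs (iter n f (toC p))) = Num.sqrt \o (@sqnorm R \o iter n F).
    by apply/funext => p; rewrite /= -toC_iter.
  move=> p; apply: continuous_comp; last exact: sqrt_continuous.
  by apply: continuous_comp; [exact: ci|exact: cs].
have -> : [set p | fast_escaping f R0 (toC p)] = \bigcup_l \bigcap_n
    (fun p => cabs (iter (n + l) f (toC p))) @^-1` [set` `[iter n (max_modulus f) R0, +oo[].
  apply/seteqP; split => p /= [l].
    by move=> H; exists l => // n _; rewrite /= in_itv/= andbT.
  by move=> _ H; exists l => n; have := H n I; rewrite /= in_itv/= andbT.
apply: bigcup_measurable => l _; apply: bigcap_measurable => [|n _]; first by exists 0.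
by apply: continuous_pmeasurable => //; exact: measurable_itv.
Qed.

(** As long as the orbit stays above height [X], avoiding the union of bad sets passes from each
    point to its image. An iterate entering the thin set would put its predecessor into
    [bad_set 1]. *)
Lemma sine_slow_bad (R0 : R) p : 0 < R0 -> X < `|p.2 + b2| ->
  ~ (\bigcup_n V n) p -> fast_escaping f R0 (toC p).
Proof.
move=> R00 Xp Vp.
apply: (@sine_fast_escaping R alpha beta X) => //; first by rewrite Im_toC_shift.
move=> n; have H m : (forall k, (k <= m)%N -> X < `|(iter k F p).2 + b2|) ->
    ~ (\bigcup_n V n) (iter m F p).
  elim: m => [//|m IH] Xm [k _ Vk].
  apply: IH => [l lm|]; first by apply: Xm; exact: leqW.
  by exists k.+1 => //; split; [exact: Xm|right].
have E k : `|complex.Im (iter k f (toC p) + beta)| = `|(iter k F p).2 + b2|.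
  by rewrite -toC_iter Im_toC_shift.
move=> Xn; rewrite E.
have {}Xn k : (k <= n)%N -> X < `|(iter k F p).2 + b2| by move=> kn; rewrite -E; exact: Xn.
have thin : ~ thin_set beta (iter n.+1 F p).
  move=> Dn; apply: (H n Xn); exists 1%N => //; split; [exact: Xn|by left].
move/negP: thin; rewrite /thin_set/= -leNgt offset_sqnormE -/(iter n.+1 F p) toC_iter.
move=> h; rewrite -(ler_pXn2r (n := 2)) ?nnegrE ?cabs_ge0 ?sqr_ge0//.
by apply: le_trans h _; rewrite real_normK ?num_real// -exprM.
Qed.

Theorem sine_area (R0 s : R) : 0 < R0 ->
  (area (vertical_strip s `&` ~` fast_escaping f R0) <= (4 * pi * X + 5 / 2)%:E)%E.
Proof.
move=> R00.
have X0 : 0 < X by rewrite -expR_gt1; apply: lt_le_trans expX; rewrite ltr1n.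
have pi0 := pi_gt0 R.
(* Points of height at most [X] are given up entirely: they fill a box of width 2 pi and height
   2X. *)
set C := `[s, s + 2 * pi]%classic `*` `[- b2 - X, - b2 + X]%classic.
have mC : pmeasurable C by exact: pmeasurable_rect.
have muC : mu C = (4 * pi * X)%:E.
  rewrite /C area_rect; [|lra|lra].
  by congr (_%:E); ring.
have mU : pmeasurable (strip s `&` \bigcup_n V n).
  apply: measurableI; first exact: pmeasurable_strip.
  by apply: bigcup_measurable => n _; apply: open_pmeasurable; exact: open_bad_set.
rewrite /area; set T := [set p | _].
apply: (@le_trans _ _ (mu (C `|` (strip s `&` \bigcup_n V n)))).
  apply: area_le.
  - have -> : T = strip s `\` [set p | fast_escaping f R0 (toC p)] by [].
    by apply: measurableD; [exact: pmeasurable_strip|exact: pmeasurable_fast_escaping].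
  - exact: measurableU.
  - move=> p [sp Ap]; have [pX|Xp] := leP `|p.2 + b2| X.
      left; split; rewrite /= in_itv/=; first exact: sp.
      by move: pX; rewrite ler_norml => /andP[? ?]; apply/andP; split; lra.
    right; split => //; apply: contrapT => Vp; apply: Ap.
    exact: sine_slow_bad.
apply: le_trans (measureU2 _ mC mU) _.
rewrite EFinD; apply: leeD; [by rewrite -muC|exact: bad_union_area].
Qed.

End SineArea.

(** * Numerical bounds, and the cosine as a shifted sine *)

Section Constants.
Variable R : realType.

(** From e = (e^(1/8))^8 >= (9/8)^8 >= 5/2. *)
Lemma expR_natr_ge n : (5 / 2) ^+ n <= expR n%:R :> R.
Proof.
have e1 : 5 / 2 <= expR 1 :> R.
  have -> : 1 = 8%:R * (1 / 8) :> R by field.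
  rewrite expRM_natl; apply: (@le_trans _ _ ((9 / 8) ^+ 8)); first lra.
  apply: lerXn2r; rewrite ?nnegrE ?expR_ge0//.
  by apply: le_trans (expR_ge1Dx _); lra.
rewrite -[n%:R]mulr1 expRM_natl; by apply: lerXn2r => //; rewrite nnegrE ?expR_ge0.
Qed.

Lemma half_le_ln2 : 1 / 2 <= ln 2 :> R.
Proof.
have h : ln (1 + - (1 / 2)) <= - (1 / 2) :> R by apply: le_ln1Dx; lra.
have e : 1 + - (1 / 2) = 2^-1 :> R by lra.
by move: h; rewrite e lnV ?posrE//; lra.
Qed.

Lemma ccosE (z : R[i]) : ccos z = csin (z + (pi / 2)%:C).
Proof.
case: z => x y; have -> : x +i* y + (pi / 2)%:C = (x + pi / 2) +i* y by simpc.
rewrite csinE sinDpihalf cosDpihalf /ccos /cexp.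
have -> : 'i%C * (x +i* y) = (- y) +i* x by simpc.
have -> : - (- y +i* x) = y +i* (- x) by simpc.
rewrite /= cosN sinN; apply: (mulIf (x := 2)); first by rewrite pnatr_eq0.
rewrite mulfVK ?pnatr_eq0// mulr_natr mulr2n.
by simpc; rewrite /cosh /sinh; congr (_ +i* _); field.
Qed.

End Constants.

(** Both claims are instances of [sine_area], with [X] equal to [xstar] in the first and to 16 in
    the second. *)
Theorem theorem1p2 (R : realType) :
  (forall (alpha beta : R[i]) (R0 a : R),
    alpha != 0 ->
    let f := fun z : R[i] => alpha * csin (z + beta) in
    escaping_radius f R0 ->
    let r : R := 8^-1 in
    let c : R := 536 * Num.sqrt 2 / cabs alpha + 1 / cabs alpha ^+ 2 in
    let K : R := Num.max (cabs alpha / 2) (cabs beta) in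
    let xstar : R :=
      Num.max (ln (1 + 18 * K / cabs alpha))
        (Num.max (ln (8 * (K + 1) / cabs alpha))
          (Num.max (6 * ln 2) (12 + 2 * ln c))) in
    (area (vertical_strip a `&` ~` fast_escaping f R0) <=
      ((4 * pi + 4 * r) *
        (xstar + r +
          8 * c * expR (4 - xstar / 2) * (r / (1 - expR (- (r / 2))))))%:E)%E)
  /\
  (forall (f : R[i] -> R[i]) (R0 a : R),
    f = @csin R \/ f = @ccos R ->
    escaping_radius f R0 ->
    (area (vertical_strip a `&` ~` fast_escaping f R0) < 361%:E)%E).
Proof.
have pi2 := pi_ge2 R; split.
  move=> alpha beta R0 s alpha0 f [R00 _]; cbv zeta.
  have a0 := cabs_gt0 alpha0; set a := cabs alpha in a0 *.
  set K := Num.max (a / 2) _.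
  set c := 536 * Num.sqrt 2 / a + _; set xstar := Num.max (ln (1 + _)) _.
  have bK : cabs beta <= K by rewrite /K le_max lexx orbT.
  have K0 : 0 <= K by apply: le_trans bK; exact: cabs_ge0.
  have sqrt2 : 7 / 5 <= Num.sqrt 2 :> R.
    have h : 0 <= 7 / 5 :> R by lra.
    by apply: sqr_le_sqrt => //; lra.
  have ac : 750 <= a * c.
    have -> : a * c = 536 * Num.sqrt 2 + a^-1 by rewrite /c; field; rewrite gt_eqF.
    have aV : 0 < a^-1 by rewrite invr_gt0.
    lra.
  have c0 : 0 < c by rewrite -(pmulr_rgt0 _ a0); lra.
  have x1 : ln (1 + 18 * K / a) <= xstar by rewrite /xstar le_max lexx.
  have x2 : 6 * ln 2 <= xstar by rewrite /xstar !le_max lexx !orbT.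
  have x3 : 12 + 2 * ln c <= xstar by rewrite /xstar !le_max lexx !orbT.
  clearbody xstar.
  have X3 : 3 <= xstar by have := half_le_ln2 R; lra.
  have Ka0 : 0 <= 18 * K / a by apply: divr_ge0; [lra|exact: ltW].
  have expX : 64 <= expR xstar.
    apply: (@le_trans _ _ (expR (6 * ln 2))); last by rewrite ler_expR.
    by rewrite expRM_natl lnK ?posrE//; lra.
  have e1 : 1 + 18 * K / a <= expR xstar.
    by rewrite -ler_ln ?posrE ?expR_gt0 ?expRK//; lra.
  have betaX : 18 * cabs beta <= a * (expR xstar - 1).
    have : a * (18 * K / a) <= a * (expR xstar - 1) by rewrite ler_wpM2l ?(ltW a0)//; lra.
    by have -> : a * (18 * K / a) = 18 * K by [field; rewrite gt_eqF]; lra.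
  have e2 : expR 6 * c <= expR (xstar / 2).
    have -> : expR 6 * c = expR (6 + ln c) by rewrite [RHS]expRD lnK.
    by rewrite ler_expR; lra.
  (* Here e^6 >= (5/2)^6 > 244, and 244 * 750 = 183000. *)
  have ae2 : 183 * 1000 <= a * expR (xstar / 2).
    have h6 := @expR_natr_ge R 6.
    have : a * (expR 6 * c) <= a * expR (xstar / 2) by rewrite ler_wpM2l ?(ltW a0).
    by rewrite mulrCA; nra.
  have e8 : 8 <= expR (xstar / 2).
    rewrite -(ler_pXn2r (n := 2)) ?nnegrE ?expR_ge0// -expRM_natl.
    have -> : 2%:R * (xstar / 2) = xstar by field.
    by lra.
  have alphaX : 1120 ^+ 2 <= a * expR xstar.
    have -> : xstar = xstar / 2 + xstar / 2 by field.
    rewrite expRD mulrA; apply: (@le_trans _ _ (183 * 1000 * 8)); first lra.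
    by apply: ler_pM; [apply: mulr_ge0; exact: ler0n|exact: ler0n|exact: ae2|exact: e8].
  have alphaX2 : 200 <= a * expR (xstar / 2) by lra.
  apply: le_trans (sine_area alpha0 expX betaX alphaX alphaX2 s R00) _.
  (* As T >= 0, the stated bound exceeds 4 pi xstar by at least xstar/2 + pi/2 + 1/16, which is more
     than 5/2 because xstar >= 3 and pi >= 2. *)
  rewrite lee_fin; set T := _ * (_ / (1 - _)).
  have T0 : 0 <= T.
    apply: mulr_ge0; first by rewrite !mulr_ge0 ?expR_ge0// ltW.
    apply: divr_ge0; first lra.
    by rewrite subr_ge0 -[leRHS]expR0 ler_expR; lra.
  have piT : 0 <= pi * T by apply: mulr_ge0 => //; lra.
  clearbody T; lra.
move=> f R0 s fE [R00 _].
have [beta fb bb] : exists2 beta, f = (fun z => 1 * csin (z + beta)) & cabs beta <= 2.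
  case: fE => ->.
    exists 0; first by apply/funext => z; rewrite mul1r addr0.
    by rewrite /cabs ComplexField.Normc.normc0; lra.
  exists (pi / 2)%:C; first by apply/funext => z; rewrite mul1r ccosE.
  have := pihalf_lt2 R; rewrite /cabs/= expr0n addr0 sqrtr_sqr ger0_norm; lra.
have a1 : cabs 1 = 1 :> R by exact: ComplexField.Normc.normc1.
have h16 := @expR_natr_ge R 16; have h8 := @expR_natr_ge R 8.
have e16 : 1300 * 1000 <= expR 16 :> R by apply: le_trans h16; lra.
have e8 : 1000 <= expR 8 :> R by apply: le_trans h8; lra.
(* The choice X = 16 is admissible since (5/2)^16 already exceeds 1120^2. As pi < 4, the resulting
   bound is below 64 * 4 + 5/2 = 258.5. *)
rewrite fb; apply: (@le_lt_trans _ _ (4 * pi * 16 + 5 / 2)%:E).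
  apply: sine_area => //; rewrite ?oner_eq0// ?a1 ?mul1r; [lra|lra|lra|].
  have -> : 16 / 2 = 8 :> R by lra.
  lra.
by rewrite lte_fin; have := pihalf_lt2 R; lra.
Qed.
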